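(* Let $S=T\circ T\circ T$ be the third iterate of the Collatz map $T:\mathbb{N}\to\mathbb{N}$, and let $Q^*=(q^*_{ij})_{i,j=0,\dots,7}$ be the $8\times 8$ matrix with entries $$q^*_{ij}:=\frac{\mu_{inv}\left[\mathcal{B}(i,8)\cap S^{-1}\mathcal{B}(j,8)\right]}{\mu_{inv}\left[\mathcal{B}(i,8)\right]}\qquad (i,j=0,\dots,7).$$ Then $Q^*$ is a stochastic matrix (nonnegative entries, each row summing to $1$) and, with rows and columns indexed from $0$ to $7$, $$Q^*=\begin{pmatrix} \frac18&\frac18&\frac18&\frac18&\frac18&\frac18&\frac18&\frac18\\ 0&\frac14&0&\frac14&0&\frac14&0&\frac14\\ \frac14&0&\frac14&0&\frac14&0&\frac14&0\\ \frac12&0&0&0&\frac12&0&0&0\\ \frac14&0&\frac14&0&\frac14&0&\frac14&0\\ \frac14&0&\frac14&0&\frac14&0&\frac14&0\\ 0&\frac14&0&\frac14&0&\frac14&0&\frac14\\ 0&0&\frac12&0&0&0&\frac12&0 \end{pmatrix}.$$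
   Context: $\mathbb{N}$ denotes the positive integers. The Collatz map $T:\mathbb{N}\to\mathbb{N}$ is $T(n)=n/2$ if $n$ is even and $T(n)=3n+1$ if $n$ is odd. For $m\ge1$ and $i\in\{0,\dots,8^m-1\}$, $\mathcal{B}(i,8^m)=\{n\in\mathbb{N}:\exists k\in\mathbb{N}\cup\{0\},\ n=i+8^mk\}$. $S^{-1}A$ denotes the preimage $\{n\in\mathbb{N}:S(n)\in A\}$. $\mu_{inv}$ is the finitely additive set function, defined on finite unions of classes $\mathcal{B}(i,8^m)$ ($m\ge 1$, $0\le i\le 8^m-1$), determined by $$\mu_{inv}(\mathcal{B}(i,8^m))=\frac{\nu(i)}{8^{m-1}},\qquad \nu(i)=\tfrac16 \text{ if } i \text{ is even},\quad \nu(i)=\tfrac1{12}\text{ if } i\text{ is odd}.$$ The sets $\mathcal{B}(i,8)\cap S^{-1}\mathcal{B}(j,8)$ are finite unions of classes modulo $64$, so their $\mu_{inv}$-values are defined. *)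

(* Defs.v *)
From HB Require Import structures.
From mathcomp Require Import all_boot all_order all_algebra.
From mathcomp Require Import all_classical all_reals all_analysis.
From mathcomp Require Import zify ring.

Set Implicit Arguments.
Unset Strict Implicit.
Unset Printing Implicit Defensive.

Import Order.TTheory GRing.Theory Num.Theory.

Local Open Scope classical_set_scope.
Local Open Scope ring_scope.

Definition posnat : Type := {n : nat | (0 < n)%N}.

HB.instance Definition _ := Choice.on posnat.
HB.instance Definition _ :=
  isPointed.Build posnat (exist (fun n => (0 < n)%N) 1%N isT).

Definition collatz_nat (n : nat) : nat :=
  if odd n then (3 * n + 1)%N else n./2.

Lemma collatz_nat_gt0 (n : nat) : (0 < n)%N -> (0 < collatz_nat n)%N.
Proof. by rewrite /collatz_nat; case: ifP => ?; lia. Qed.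

Definition collatz (n : posnat) : posnat :=
  exist (fun n => (0 < n)%N) (collatz_nat (sval n))
    (collatz_nat_gt0 (svalP n)).

Definition collatz3 : posnat -> posnat := collatz \o collatz \o collatz.

Definition resclass (i q : nat) : set posnat :=
  [set n | exists k : nat, sval n = (i + q * k)%N].

(* The finite unions of classes B(i, 8^m), with m allowed to vary from one
   class to the next: a pair c stands for B(c.2, 8^c.1). *)
Definition finite_union_of_classes (A : set posnat) : Prop :=
  exists s : seq (nat * nat),
    all (fun c => (0 < c.1)%N && (c.2 < 8 ^ c.1)%N) s /\
    A = \big[setU/set0]_(c <- s) resclass c.2 (8 ^ c.1)%N.

Definition nu (R : realType) (i : nat) : R := if odd i then 12^-1 else 6^-1.

(* Every finite union of classes is a union of classes of one common modulus
   8^m, hence of pairwise disjoint ones, and its value is the sum of the values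
   of these (independent of m, see mu_inv_class and mu_inv_unique). On the other
   sets the value is the junk value 0. *)
Definition mu_inv (R : realType) (A : set posnat) : \bar R :=
  (xget 0 [set x : R | exists (m : nat) (I : pred nat),
     [/\ (0 < m)%N,
         A = \big[setU/set0]_(i < 8 ^ m | I i) resclass i (8 ^ m)
       & x = \sum_(i < 8 ^ m | I i) nu R i / 8 ^+ m.-1]])%:E.

Definition Qstar (R : realType) : 'M[R]_8 :=
  \matrix_(i < 8, j < 8)
    (fine (mu_inv R (resclass i 8 `&` collatz3 @^-1` resclass j 8)) /
     fine (mu_inv R (resclass i 8))).

Definition stochastic (R : realType) (n : nat) (Q : 'M[R]_n) : Prop :=
  (forall i j, 0 <= Q i j) /\ (forall i, \sum_j Q i j = 1).

Definition saturated (m : nat) (A : set posnat) : Prop :=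
  forall n n' : posnat, sval n = sval n' %[mod 8 ^ m] -> A n -> A n'.

Lemma rep_subproof (m a : nat) : (0 < a + 8 ^ m)%N.
Proof. by rewrite addn_gt0 expn_gt0 orbT. Qed.

Definition rep (m a : nat) : posnat :=
  exist (fun n => (0 < n)%N) (a + 8 ^ m)%N (rep_subproof m a).

Lemma rep_mod (m : nat) (n : posnat) :
  sval (rep m (sval n %% 8 ^ m)) = sval n %[mod 8 ^ m].
Proof. by rewrite /= modnDr modn_mod. Qed.

Lemma resclassE (i m : nat) (n : posnat) : (i < 8 ^ m)%N ->
  resclass i (8 ^ m) n <-> (sval n %% 8 ^ m)%N = i.
Proof.
move=> im; split=> [[k ->]|<-]; first by rewrite addnC mulnC modnMDl modn_small.
by exists (sval n %/ 8 ^ m)%N; rewrite mulnC addnC -divn_eq.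
Qed.

Lemma saturated_le (m p : nat) (A : set posnat) :
  (m <= p)%N -> saturated m A -> saturated p A.
Proof.
move=> mp sA n n' nn'; apply: sA.
have d : (8 ^ m %| 8 ^ p)%N by rewrite dvdn_exp2l.
by rewrite -(modn_dvdm (sval n) d) -(modn_dvdm (sval n') d) nn'.
Qed.

Lemma saturated_class (i m : nat) : (i < 8 ^ m)%N ->
  saturated m (resclass i (8 ^ m)).
Proof.
by move=> im n n' nn' /(resclassE _ im) e; apply/(resclassE _ im); rewrite -nn'.
Qed.

Lemma saturatedU (m : nat) (A B : set posnat) :
  saturated m A -> saturated m B -> saturated m (A `|` B).
Proof.
by move=> sA sB n n' nn' [/(sA _ _ nn')|/(sB _ _ nn')]; [left|right].
Qed.

Lemma saturatedC (m : nat) (A : set posnat) :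
  saturated m A -> saturated m (~` A).
Proof. by move=> sA n n' nn' An An'; apply: An; apply: sA An'. Qed.

Lemma saturated_bigU (m : nat) (I : pred nat) :
  saturated m (\big[setU/set0]_(i < 8 ^ m | I i) resclass i (8 ^ m)).
Proof.
apply: (big_ind (saturated m)) => //; first exact: saturatedU.
by move=> i _; exact: saturated_class.
Qed.

Lemma rep_bigU (m : nat) (I : pred nat) (n : posnat) :
  (\big[setU/set0]_(i < 8 ^ m | I i) resclass i (8 ^ m)) n <->
  I (sval n %% 8 ^ m)%N.
Proof.
rewrite -(big_mkord I (fun i => resclass i (8 ^ m))) -bigcup_seq_cond.
have n8 : (sval n %% 8 ^ m < 8 ^ m)%N by rewrite ltn_mod expn_gt0.
split=> [[i /= /andP[+ Ii]]|In].
  by rewrite mem_index_iota => /= im /(resclassE _ im) ->.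
exists (sval n %% 8 ^ m)%N; last exact/resclassE.
by rewrite /= mem_index_iota n8.
Qed.

Lemma saturatedE (m : nat) (A : set posnat) : saturated m A ->
  A = \big[setU/set0]_(i < 8 ^ m | `[< A (rep m i) >]) resclass i (8 ^ m).
Proof.
move=> sA; apply/seteqP; split=> n.
  move=> An; apply/(@rep_bigU m (fun i => `[< A (rep m i) >])).
  by apply/asboolP; apply: sA An; rewrite rep_mod.
move=> /(@rep_bigU m (fun i => `[< A (rep m i) >])) /asboolP.
by apply: sA; rewrite rep_mod.
Qed.

Lemma finite_union_saturated (A : set posnat) :
  finite_union_of_classes A <-> exists2 m, (0 < m)%N & saturated m A.
Proof.
split=> [[s [+ ->]]|[m m0 sA]].
  elim: s => [|c s IH] /=; first by exists 1%N => //; rewrite big_nil.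
  move=> /andP[/andP[c0 c8] /IH [m m0 sm]]; rewrite big_cons.
  exists (maxn c.1 m); first by rewrite leq_max m0 orbT.
  apply: saturatedU; last by apply: saturated_le sm; rewrite leq_maxr.
  by apply: saturated_le (saturated_class c8); rewrite leq_maxl.
exists [seq (m, i) | i <- index_iota 0 (8 ^ m) & `[< A (rep m i) >]]; split.
  apply/allP => c /mapP[i]; rewrite mem_filter mem_index_iota => /andP[_ i8] ->.
  by rewrite /= m0.
by rewrite big_map big_filter big_mkord; exact: saturatedE.
Qed.

Lemma finite_union_set0 : finite_union_of_classes set0.
Proof. by exists [::]; rewrite big_nil. Qed.

Lemma finite_unionU : setU_closed finite_union_of_classes.
Proof.
move=> A B [s [sP ->]] [t [tP ->]]; exists (s ++ t).
by rewrite all_cat sP tP big_cat.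
Qed.

Lemma finite_unionC : setC_closed finite_union_of_classes.
Proof.
move=> A /finite_union_saturated[m m0 sA]; apply/finite_union_saturated.
by exists m => //; exact: saturatedC.
Qed.

HB.instance Definition _ :=
  isAlgebraOfSets.Build default_measure_display posnat
    finite_union_set0 finite_unionU finite_unionC.

Section MuInv.
Variable R : realType.

Let weight (m : nat) (A : set posnat) : R :=
  \sum_(i < 8 ^ m | `[< A (rep m i) >]) nu R i / 8 ^+ m.-1.

Let weightS (m : nat) (A : set posnat) : (0 < m)%N -> saturated m A ->
  weight m.+1 A = weight m A.
Proof.
case: m => // m _ sA; rewrite /weight !big_mkcond /=.
rewrite -(big_mkord xpredT (fun i => if `[< A (rep m.+2 i) >]
  then nu R i / 8 ^+ m.+1 else 0)).
rewrite (expnS 8 m.+1) big_nat_mul.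
rewrite (eq_big_nat _ _ (F2 := fun=> \sum_(0 <= i < 8 ^ m.+1)
   if `[< A (rep m.+1 i) >] then nu R i / 8 ^+ m.+1 else 0)).
  rewrite sumr_const_nat -sumrMnl big_mkord [RHS]big_mkcond /=.
  apply: eq_bigr => i _.
  case: ifP => _; last by rewrite mul0rn.
  rewrite subn0 exprS -mulr_natr invfM; field.
  by rewrite expf_neq0.
move=> b _; rewrite -{1}[(b * _)%N]add0n mulSn big_addn addnK.
apply: eq_bigr => a _.
have -> : nu R (a + b * 8 ^ m.+1) = nu R a.
  by rewrite /nu oddD oddM oddX andbF addbF.
congr (if _ then _ else _); apply: asbool_equiv_eq.
have e : sval (rep m.+2 (a + b * 8 ^ m.+1)) = sval (rep m.+1 a)
    %[mod 8 ^ m.+1].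
  by rewrite /= modnDr (expnS 8 m.+1) -addnA -mulnDl addnC modnMDl.
by split; apply: sA.
Qed.

Let weight_le (m p : nat) (A : set posnat) : (0 < m)%N -> (m <= p)%N ->
  saturated m A -> weight p A = weight m A.
Proof.
move=> m0 /subnK <-; elim: (p - m)%N => // d IH sA.
rewrite addSn weightS ?IH ?addn_gt0 ?m0 ?orbT //.
by apply: saturated_le sA; rewrite leq_addl.
Qed.

Let mu_inv_weight (m : nat) (A : set posnat) : (0 < m)%N -> saturated m A ->
  mu_inv R A = (weight m A)%:E.
Proof.
move=> m0 sA; rewrite /mu_inv; congr (_%:E); apply: xget_unique.
  exists m, (fun i => `[< A (rep m i) >]); split => //; exact: saturatedE.
move=> x [p [I [p0 AE ->]]].
have sAp : saturated p A by rewrite AE; exact: saturated_bigU.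
have -> : weight m A = weight p A.
  by case/orP: (leq_total m p) => mp; [rewrite -(weight_le m0 mp sA)
    | rewrite (weight_le p0 mp sAp)].
apply: eq_bigl => i; rewrite AE; apply/idP/asboolP => [Ii|].
  by apply/rep_bigU; rewrite /= modnDr modn_small.
by move=> /rep_bigU; rewrite /= modnDr modn_small.
Qed.

Lemma mu_inv_class (m i : nat) : (0 < m)%N -> (i < 8 ^ m)%N ->
  mu_inv R (resclass i (8 ^ m)) = (nu R i / 8 ^+ m.-1)%:E.
Proof.
move=> m0 im; rewrite (mu_inv_weight m0 (saturated_class im)) /weight.
congr (_%:E); rewrite (big_pred1 (Ordinal im)) // => j /=.
apply/asboolP/eqP => [/(resclassE _ im)|->].
  by rewrite /= modnDr modn_small // => ji; exact: val_inj.
by apply/(resclassE _ im); rewrite /= modnDr modn_small.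
Qed.

Let nu_ge0 (m i : nat) : 0 <= nu R i / 8 ^+ m.
Proof. by rewrite /nu; case: ifP => _; rewrite divr_ge0 ?exprn_ge0. Qed.

Let mu_inv_ge0 (A : set posnat) : (0 <= mu_inv R A)%E.
Proof.
rewrite /mu_inv lee_fin; case: xgetP => // x _ [m [I [_ _ ->]]].
by apply: sumr_ge0.
Qed.

Let mu_inv0 : mu_inv R set0 = 0%E.
Proof.
rewrite (@mu_inv_weight 1) // /weight big_pred0 // => i.
by apply/negbTE/asboolP.
Qed.

Let mu_inv_semi_additive : measure_function.semi_additive (mu_inv R).
Proof.
apply/additive2P; first exact: mu_inv0.
move=> A B /finite_union_saturated[m m0 sA].
move=> /finite_union_saturated[p p0 sB] AB.
have k0 : (0 < maxn m p)%N by rewrite leq_max m0.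
have {}sA := saturated_le (leq_maxl m p) sA.
have {}sB := saturated_le (leq_maxr m p) sB.
rewrite !(mu_inv_weight k0) //; last exact: saturatedU.
rewrite -EFinD /weight; congr (_%:E); set k := maxn m p.
rewrite (bigID (fun i : 'I_(8 ^ k) => `[< A (rep k i) >])) /=.
congr (_ + _); apply: eq_bigl => i.
  by apply/andP/asboolP => [[_ /asboolP]//|Ai]; split; apply/asboolP => //; left.
apply/andP/asboolP => [[/asboolP[Ai|//] /asboolP]//|Bi].
split; first by apply/asboolP; right.
by apply/asboolP => Ai; have : (A `&` B) (rep k i) by []; rewrite AB.
Qed.

HB.instance Definition _ := isContent.Build _ posnat R (mu_inv R)
  mu_inv_ge0 mu_inv_semi_additive.

Lemma mu_inv_unique (mu : {content set posnat -> \bar R}) :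
  (forall m i, (0 < m)%N -> (i < 8 ^ m)%N ->
     mu (resclass i (8 ^ m)) = (nu R i / 8 ^+ m.-1)%:E) ->
  forall A, finite_union_of_classes A -> mu A = mu_inv R A.
Proof.
move=> muE A /finite_union_saturated[m m0 sA].
have lt8 (i : 'I_(8 ^ m)) : (i < 8 ^ m)%N by [].
rewrite (mu_inv_weight m0 sA) {1}(saturatedE sA) measure_bigsetU_ord.
- by rewrite /weight -sumEFin; apply: eq_bigr => i _; exact: muE.
- move=> i; apply/finite_union_saturated.
  by exists m => //; exact: saturated_class.
- move=> i j _ _ [n [/(resclassE _ (lt8 i)) ni /(resclassE _ (lt8 j)) nj]].
  by apply: val_inj; rewrite /= -ni -nj.
Qed.

End MuInv.

(* Main.v *)
Require Import Defs.
From mathcomp Require Import all_boot all_order all_algebra.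
From mathcomp Require Import all_classical all_reals all_analysis.
From mathcomp Require Import ring.

(** One Collatz step divides by 2 at most once, so the residue of [T n] modulo
    [q] is determined by that of [n] modulo [2 * q]; three steps give that
    [S n] modulo 8 depends only on [n] modulo 64.  Hence the set of the [n] in
    the class of [i] with [S n] in the class of [j] is the union of the classes
    modulo 64 of the [n < 64] with [n = i] and [S n = j] modulo 8.  These [n]
    have the parity of [i], so each of their classes has measure [nu i / 8],
    while the class of [i] modulo 8 has measure [nu i].  The quotient is
    therefore a plain proportion,
      [Qstar i j = transition_count i j / 8]   ([QstarE]),
    in which the invariant measure has disappeared.  For fixed [i] the counts
    add up to the 8 residues modulo 64 that lie above [i]
    ([sum_transition_count]), so [Qstar] is stochastic, and its 64 entries are
    obtained by evaluating the counts. *)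

Import Order.TTheory GRing.Theory Num.Theory.

Local Open Scope classical_set_scope.
Local Open Scope ring_scope.

(** The residue of the image modulo [q] needs the argument only modulo
    [2 * q]: raising [n] by [2 * q] raises [collatz_nat n] by [q] or by
    [6 * q], according to the parity of [n]. *)
Lemma collatz_nat_mod (q a b : nat) :
  (a = b %[mod 2 * q] -> collatz_nat a = collatz_nat b %[mod q])%N.
Proof.
wlog ab : a b / (a <= b)%N.
  by move=> th; case/orP: (leq_total a b) => /th // h /esym/h.
move=> /esym/eqP; rewrite eqn_mod_dvd // => /dvdnP[k bE].
have {ab bE} -> : b = (a + k * (2 * q))%N by rewrite -bE subnKC.
rewrite /collatz_nat oddD mulnCA oddM /= addbF.
case: ifP => _.
  have -> : (3 * (a + 2 * (k * q)) + 1 = 6 * k * q + (3 * a + 1))%N by ring.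
  by rewrite modnMDl.
by rewrite halfD oddM andbF mul2n doubleK add0n addnC modnMDl.
Qed.

(** Defined at 0 as well, unlike [collatz3]: the representative 0 of the class
    of multiples of 64 can then be used in the counts. *)
Definition collatz3_nat (n : nat) : nat :=
  collatz_nat (collatz_nat (collatz_nat n)).

Lemma collatz3_nat_mod8 (a b : nat) :
  (a = b %[mod 64] -> collatz3_nat a = collatz3_nat b %[mod 8])%N.
Proof.
move=> ab; rewrite /collatz3_nat.
apply: collatz_nat_mod; apply: collatz_nat_mod; exact: collatz_nat_mod.
Qed.

Definition transition_pred (i j n : nat) : bool :=
  (n %% 8 == i)%N && (collatz3_nat n %% 8 == j)%N.

Lemma transition_setE (i j : 'I_8) :
  resclass i 8 `&` collatz3 @^-1` resclass j 8 =
  \big[setU/set0]_(n < 8 ^ 2 | transition_pred i j n) resclass n (8 ^ 2).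
Proof.
apply/seteqP; split=> n.
- move=> [/(@resclassE i 1 _ (ltn_ord i)) ni].
  move=> /(@resclassE j 1 _ (ltn_ord j)) nj.
  apply/(@rep_bigU 2 (transition_pred i j)); apply/andP; split; apply/eqP.
  + by rewrite modn_dvdm.
  + by rewrite (@collatz3_nat_mod8 _ (sval n)) ?modn_mod.
- move=> /(@rep_bigU 2 (transition_pred i j)) /andP[/eqP ni /eqP nj].
  split.
  + by apply/(@resclassE i 1 _ (ltn_ord i)); rewrite -ni modn_dvdm.
  + apply/(@resclassE j 1 _ (ltn_ord j)).
    by rewrite -nj; apply: collatz3_nat_mod8; rewrite modn_mod.
Qed.

(** The content is additive over disjoint classes of one modulus. *)
Lemma mu_inv_bigU (R : realType) (m : nat) (I : pred nat) : (0 < m)%N ->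
  mu_inv R (\big[setU/set0]_(i < 8 ^ m | I i) resclass i (8 ^ m)) =
  (\sum_(i < 8 ^ m | I i) nu R i / 8 ^+ m.-1)%:E.
Proof.
move=> m0; have lt8 (i : 'I_(8 ^ m)) : (i < 8 ^ m)%N by [].
rewrite measure_bigsetU_ord_cond.
- by rewrite -sumEFin; apply: eq_bigr => i _; exact: mu_inv_class.
- move=> i _; apply/finite_union_saturated.
  by exists m => //; exact: saturated_class.
- move=> i j _ _ [n [/(resclassE _ (lt8 i)) ni /(resclassE _ (lt8 j)) nj]].
  by apply: val_inj; rewrite /= -ni -nj.
Qed.

Definition transition_count (i j : nat) : nat :=
  count (transition_pred i j) (iota 0 64).

(** All residues modulo 64 above one residue [i] modulo 8 have the parity of
    [i], hence the same weight [nu i / 8]; the weight therefore cancels from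
    the quotient and only a proportion among 8 classes remains. *)
Lemma QstarE (R : realType) (i j : 'I_8) :
  Qstar R i j = (transition_count i j)%:R / 8.
Proof.
have nu0 : nu R i != 0 by rewrite /nu; case: ifP => _; rewrite invr_eq0.
rewrite mxE transition_setE mu_inv_bigU //.
rewrite (@mu_inv_class R 1 i isT (ltn_ord i)) /= expr0 divr1 expr1.
(* [n] has the parity of [i] because [i] is its remainder modulo 8. *)
rewrite (eq_bigr (fun=> nu R i / 8)); last first.
  by move=> n /andP[/eqP <- _]; rewrite /nu odd_mod.
rewrite -(big_mkord (transition_pred i j) (fun=> nu R i / 8)).
rewrite big_const_seq iter_addr_0 /index_iota subn0 -/(transition_count i j).
by rewrite -mulr_natr; field.
Qed.

(** Each of the 8 numbers [n < 64] above [i] is counted for exactly one [j],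
    the residue of [collatz3_nat n]. *)
Lemma sum_transition_count (i : 'I_8) :
  (\sum_(j < 8) transition_count i j = 8)%N.
Proof.
transitivity (count (fun n => n %% 8 == i)%N (iota 0 64)); last first.
  by case: i; do 8?case=> //.
rewrite -[RHS]sum1_count.
rewrite (partition_big (fun n => inord (collatz3_nat n %% 8) : 'I_8) xpredT) //.
apply: eq_bigr => j _; rewrite /transition_count -sum1_count.
apply: eq_bigl => n; rewrite /transition_pred; congr (_ && _).
by rewrite -val_eqE /= inordK // ltn_mod.
Qed.

Theorem proposition10 (R : realType) :
  stochastic (Qstar R) /\
  Qstar R = \matrix_(i < 8, j < 8) (nth [::]
    [:: [:: 1/8; 1/8; 1/8; 1/8; 1/8; 1/8; 1/8; 1/8];
        [:: 0;   1/4; 0;   1/4; 0;   1/4; 0;   1/4];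
        [:: 1/4; 0;   1/4; 0;   1/4; 0;   1/4; 0  ];
        [:: 1/2; 0;   0;   0;   1/2; 0;   0;   0  ];
        [:: 1/4; 0;   1/4; 0;   1/4; 0;   1/4; 0  ];
        [:: 1/4; 0;   1/4; 0;   1/4; 0;   1/4; 0  ];
        [:: 0;   1/4; 0;   1/4; 0;   1/4; 0;   1/4];
        [:: 0;   0;   1/2; 0;   0;   0;   1/2; 0  ]] i)`_j.
Proof.
split; first split.
- by move=> i j; rewrite QstarE divr_ge0.
- move=> i; under eq_bigr do rewrite QstarE.
  by rewrite -mulr_suml -natr_sum sum_transition_count divff.
have e84 : 2 / 8 = 1 / 4 :> R by field.
have e82 : 4 / 8 = 1 / 2 :> R by field.
apply/matrixP => i j; rewrite QstarE mxE.
(* In each of the 64 cases the count evaluates to 0, 1, 2 or 4. *)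
by case: i => i; do 8?[case: i => [|i]]; case: j => j;
  do 8?[case: j => [|j]] => //= _ _; rewrite ?mul0r.
Qed.
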